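(* If $G$ is a finite simple graph with minimum degree $\delta(G)\ge 7$, then $\mathrm{Maj}'(G)\le 4$.
   Context: Two distinct edges are adjacent if they share an endpoint. An edge-coloring $c:E\to C$ (not necessarily proper) of a graph $G=(V,E)$ is a strong majority edge-coloring if for every edge $e\in E$ and every color $\alpha\in C$, at most half of the edges adjacent to $e$ have color $\alpha$. The strong majority index $\mathrm{Maj}'(G)$ is the least number of colors in such a coloring. *)

(* Defs.v *)
From mathcomp Require Import all_boot.

Set Implicit Arguments.
Unset Strict Implicit.
Unset Printing Implicit Defensive.

Record sgraph := SGraph {
  vertex :> finType;
  vadj : rel vertex;
  vadj_sym : symmetric vadj;
  vadj_irrefl : irreflexive vadj
}.

Section Graph.

Variable G : sgraph.

Definition degree (x : G) : nat := #|[set y : G | vadj x y]|.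

(* Every degree is less than #|G|, so the default #|G| is neutral when G has
   a vertex; the graph without vertices gets minimum degree 0. *)
Definition min_degree : nat := \big[minn/#|G|]_(x : G) degree x.

Definition edge_set : {set {set G}} :=
  [set [set p.1; p.2] | p : G * G & vadj p.1 p.2].

Definition edge := {e : {set G} | e \in edge_set}.

Definition edge_adj (e f : edge) : bool :=
  (e != f) && (val e :&: val f != set0).

(* "At most half" is stated without division; halving in nat would round. *)
Definition strong_majority_coloring (C : eqType) (c : edge -> C) : Prop :=
  forall (e : edge) (a : C),
    2 * #|[set f : edge | edge_adj e f && (c f == a)]|
      <= #|[set f : edge | edge_adj e f]|.

(* The k available colors need not all occur. *)
Definition strong_majority_colorable (k : nat) : Prop :=
  exists c : edge -> 'I_k, strong_majority_coloring c.

(* Maj'(G) = m, as a relation: some graphs (e.g. the path with two edges)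
   have no strong majority edge-coloring, hence no index. *)
Definition strong_majority_index (m : nat) : Prop :=
  strong_majority_colorable m /\
  (forall k : nat, strong_majority_colorable k -> m <= k).

Lemma degree_lt (x : G) : degree x < #|G|.
Proof.
rewrite /degree -cardsT; apply: proper_card; apply/properP; split.
  exact: subsetT.
by exists x; rewrite ?inE // vadj_irrefl.
Qed.

Lemma leq_min_degree (d : nat) (x0 : G) :
  (d <= min_degree) = [forall x : G, d <= degree x].
Proof.
apply/idP/forallP => [+ x | dle]; last first.
  apply: (big_ind (fun m => d <= m)) => //.
  - exact: leq_trans (dle x0) (ltnW (degree_lt x0)).
  - by move=> m n dm dn; rewrite leq_min dm.
rewrite /min_degree; have := mem_index_enum x.
elim: (index_enum G) => //= y s IHs; rewrite in_cons big_cons leq_min.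
by case/predU1P => [<- /andP[] // | xs /andP[_ /(IHs xs)]].
Qed.

End Graph.

(* Main.v *)
(* If every vertex v has fewer than d(v)/2 incident edges of each color, then
   the coloring is a strong majority coloring, since an edge uv has
   d(u) + d(v) - 2 adjacent edges.  Such a coloring with four colors comes from
   halving the edge set and then halving both halves, where halving means a
   2-coloring whose color classes differ by at most 2 at every vertex: a color
   of the final coloring occurs n times at v with 4n <= d(v) + 6, and this
   implies 2n < d(v) as soon as d(v) >= 7.

   Halvings exist by a vector balancing argument.  View edges as integer
   vectors, indexed by the vertices, of l1-norm at most 2.  As long as two of
   the vectors overlap at a vertex, replace them by their sum or difference,
   with the sign that creates cancellation at that vertex; the l1-norm stays at
   most 2.  When the supports are disjoint, any choice of signs works. *)
Require Import Defs.
From mathcomp Require Import all_boot.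
From mathcomp Require Import all_order all_algebra zify.

Import Order.TTheory GRing.Theory Num.Theory.

Section Balancing.

Local Open Scope ring_scope.

(** Opposite signs for [a] and [s * b] leave the difference of [|a|] and [|b|], which is their sum
    minus twice the smaller; nonzero integers make the smaller at least 1. *)
Lemma exists_cancelling_sign (a b : int) : a != 0 -> b != 0 ->
  exists2 s : int, `|s| = 1 & `|a + s * b| <= `|a| + `|b| - 2%:Z.
Proof.
move=> a0 b0; have [ab|ab] := boolP ((0 < a) == (0 < b)).
  by exists (-1); lia.
by exists 1; lia.
Qed.

(** The cancellation at [v] saves 2, and the triangle inequality handles the other coordinates, so
    the new norm is at most 2 + 2 - 2. *)
Lemma l1_cancel (V : finType) (f g : V -> int) (v : V) :
    f v != 0 -> g v != 0 ->
    \sum_w `|f w| <= 2%:Z -> \sum_w `|g w| <= 2%:Z ->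
  exists2 s : int, `|s| = 1 & \sum_w `|f w + s * g w| <= 2%:Z.
Proof.
move=> fv gv; rewrite (bigD1 v) //= [X in _ -> X <= _ -> _](bigD1 v) //= => fle gle.
have [s s1 sle] := exists_cancelling_sign _ _ fv gv; exists s => //.
rewrite (bigD1 v) //=.
have : \sum_(w | w != v) `|f w + s * g w|
    <= \sum_(w | w != v) `|f w| + \sum_(w | w != v) `|g w|.
  rewrite -big_split /=; apply: ler_sum => w _.
  by apply: le_trans (ler_normD _ _) _; rewrite normrM s1 mul1r.
move: fle gle sle; move: `|_ + _| `|f v| `|g v| => m a b.
by do 3!move: (\sum_(_ | _) _) => ?; lia.
Qed.

Lemma balancing_signs (E V : finType) (S : {set E}) (f : E -> V -> int) :
    (forall e, e \in S -> \sum_v `|f e v| <= 2%:Z) ->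
  exists2 x : E -> int, forall e, `|x e| = 1
    & forall v, `|\sum_(e in S) x e * f e v| <= 2%:Z.
Proof.
have [n] := ubnP #|S|; elim: n => // n IHn in S f *.
rewrite ltnS => leSn fle.
have [/existsP[[i j] /existsP[v /and5P[/= iS jS ij fi fj]]]|disj] := boolP
    [exists p : E * E, exists v : V,
      [&& p.1 \in S, p.2 \in S, p.1 != p.2, f p.1 v != 0 & f p.2 v != 0]].
  have [s s1 sle] := l1_cancel _ _ _ _ fi fj (fle _ iS) (fle _ jS).
  (* The merged vector is stored at [i], and [j] leaves [S]. Undoing the merge gives [j] the sign
     [s * x i], which keeps the signed sum unchanged. *)
  pose g e w := if e == i then f i w + s * f j w else f e w.
  have [||x x1 xle] := IHn (S :\ j) g.
  - by move: leSn; rewrite (cardsD1 j) jS.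
  - move=> e; rewrite in_setD1 /g => /andP[_ eS].
    by case: (e == i) => //; apply: fle.
  exists (fun e => if e == j then s * x i else x e).
    by move=> e; case: (e == j); rewrite ?normrM ?s1 ?x1.
  move=> w; have := xle w; congr (`| _ | <= _).
  have iSj : i \in S :\ j by rewrite in_setD1 ij.
  rewrite [RHS](big_setD1 j) //= eqxx.
  rewrite [in LHS](big_setD1 i) // [in RHS](big_setD1 i) //= /g eqxx (negPf ij).
  rewrite mulrDr addrA -[RHS]addrA.
  rewrite [s * x i]mulrC -[x i * s * _]mulrA [in LHS](addrC (x i * f i w)) -addrA.
  congr (_ + (_ + _)); apply: eq_bigr => e.
  by rewrite !in_setD1 => /and3P[/negPf-> /negPf->].
(* Supports are now disjoint: at most one vector is nonzero at [v], and its entry there is bounded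
   by its l1-norm. *)
exists (fun=> 1) => // v.
have [/exists_inP[i iS fi]|none] := boolP [exists i in S, f i v != 0].
  rewrite (bigD1 i) //= mul1r big1 ?addr0 => [|j /andP[jS ji]].
    apply: le_trans (fle i iS); rewrite (bigD1 v) //= lerDl.
    by apply: sumr_ge0 => w _; apply: normr_ge0.
  apply/eqP; rewrite mul1r; apply: contraNT disj => fj.
  apply/existsP; exists (i, j); apply/existsP; exists v.
  by rewrite /= iS jS fi fj eq_sym ji.
rewrite big1 ?normr0 // => i iS; rewrite mul1r; apply/eqP.
by apply: contraNT none => fi; apply/exists_inP; exists i.
Qed.

End Balancing.

(** Signs balancing the 0/1 incidence vectors are the two colors: the signed sum at [v] is the
    difference of the class sizes there. A general [S] allows halving a half again. *)
Lemma halving (E V : finType) (ends : E -> {set V}) (S : {set E}) :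
    (forall e, #|ends e| <= 2) ->
  exists c : E -> bool, forall v b,
    2 * #|[set e in S | (v \in ends e) && (c e == b)]|
      <= #|[set e in S | v \in ends e]| + 2.
Proof.
move=> ends2.
have [|x x1 xle] := balancing_signs E V S (fun e v => Posz (v \in ends e)).
  move=> e _; rewrite (eq_bigr (fun v => Posz (v \in ends e))) //.
  rewrite -(big_morph Posz PoszD (erefl (Posz 0))) lez_nat.
  by rewrite -[X in X <= 2]big_mkcond /= sum1_card.
exists (fun e => x e == 1%R) => v b; move: (xle v).
set A := [set e in S | v \in ends e].
rewrite (bigID (fun e => v \in ends e)) /= addrC big1 ?add0r; last first.
  by move=> e /andP[_ /negPf->]; rewrite mulr0.
rewrite (bigID (fun e => x e == 1%R)) /=.
pose B b' := [set e in S | (v \in ends e) && ((x e == 1%R) == b')].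
have Bsum b' : (\sum_(e | e \in B b') x e = (if b' then 1 else -1) * (#|B b'|)%:Z)%R.
  rewrite (eq_bigr (fun=> if b' then 1%R else (-1)%R)); last first.
    by move=> e; rewrite inE => /and3P[_ _]; case: b' => /=; have := x1 e; lia.
  by rewrite sumr_const -mulr_natr natz.
have -> : (\sum_(e | [&& e \in S & v \in ends e] && (x e == 1)) x e * (v \in ends e)
    = (#|B true|)%:Z)%R.
  rewrite -[RHS]mul1r -(Bsum true); apply: eq_big => e.
    by rewrite inE eqb_id andbA.
  by case/andP => /andP[_ ->] _; rewrite mulr1.
have -> : (\sum_(e | [&& e \in S & v \in ends e] && (x e != 1)) x e * (v \in ends e)
    = - (#|B false|)%:Z)%R.
  rewrite -mulN1r -(Bsum false); apply: eq_big => e.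
    by rewrite inE eqbF_neg andbA.
  by case/andP => /andP[_ ->] _; rewrite mulr1.
have : #|A| = #|B true| + #|B false|.
  rewrite -(cardsID [set e | x e == 1%R] A); congr (_ + _); apply: eq_card => e.
    by rewrite !inE eqb_id andbA.
  by rewrite !inE eqbF_neg andbC andbA.
by case: b; rewrite -/(B _); lia.
Qed.

Lemma quartering (E V : finType) (ends : E -> {set V}) :
    (forall e, #|ends e| <= 2) ->
  exists c : E -> 'I_4, forall v a,
    4 * #|[set e | (v \in ends e) && (c e == a)]|
      <= #|[set e | v \in ends e]| + 6.
Proof.
move=> ends2; have [h hP] := halving E V ends setT ends2.
have [h1 h1P] := halving E V ends [set e | h e] ends2.
have [h0 h0P] := halving E V ends [set e | ~~ h e] ends2.
(* The color has two binary digits: [h e] is the low one and names the half, [k e] is the high one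
   and names the side within that half. For a half with [m] edges at [v], [2n <= m + 2] and
   [2m <= d + 2] give [4n <= d + 6]. *)
pose k e := if h e then h1 e else h0 e.
exists (fun e => inord (h e + 2 * k e)) => v a.
pose b := odd a; pose b' := 1 < a.
have sub : [set e | (v \in ends e) && (inord (h e + 2 * k e) == a)]
    \subset [set e | [&& v \in ends e, h e == b & k e == b']].
  apply/subsetP => e; rewrite !inE => /andP[-> /eqP/(congr1 val)].
  rewrite /= inordK /b /b'; last by case: (h e); case: (k e).
  by move=> <-; case: (h e); case: (k e).
have := subset_leq_card sub; have := hP v b.
have -> : [set e in [set: E] | v \in ends e] = [set e | v \in ends e].
  by apply/setP => e; rewrite !inE.
have -> : [set e in [set: E] | (v \in ends e) && (h e == b)]
    = [set e | (v \in ends e) && (h e == b)].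
  by apply/setP => e; rewrite !inE.
suff : 2 * #|[set e | [&& v \in ends e, h e == b & k e == b']]|
    <= #|[set e | (v \in ends e) && (h e == b)]| + 2 by lia.
case: (b); [move: (h1P v b') | move: (h0P v b')].
  congr (2 * _ <= _ + 2); apply: eq_card => e;
  by rewrite !inE /k; case: (h e); rewrite ?andbT ?andbF //= andbF.
congr (2 * _ <= _ + 2); apply: eq_card => e;
by rewrite !inE /k; case: (h e); rewrite ?andbT ?andbF //= andbF.
Qed.

Section StrongMajority.

Variable G : sgraph.

Definition star (x : G) : {set edge G} := [set f : edge G | x \in val f].

Lemma edgeP (e : edge G) : exists u v : G, vadj u v /\ val e = [set u; v].
Proof.
have /imsetP[[u v]] := valP e; rewrite inE => uv ->.
by exists u, v.
Qed.

Lemma card_star (x : G) : #|star x| = degree x.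
Proof.
have inj : {in [set y | vadj x y] &, injective (fun y => [set x; y])}.
  move=> y z; rewrite !inE => xy xz /setP/(_ y); rewrite !inE eqxx orbT.
  by have [yx|_] := eqVneq y x; [rewrite yx vadj_irrefl in xy | move/esym/eqP].
rewrite /degree -(card_imset _ val_inj) -(card_in_imset inj); apply: eq_card => A.
apply/imsetP/imsetP => [[f]|[y]]; rewrite inE.
  have [u [v [uv ->]]] := edgeP f; rewrite !inE => /orP[] /eqP-> ->.
    by exists v; rewrite ?inE.
  by exists u; rewrite ?inE 1?vadj_sym // setUC.
move=> xy ->; have xyE : [set x; y] \in edge_set G by apply/imsetP; exists (x, y); rewrite ?inE.
by exists (Sub [set x; y] xyE : edge G); rewrite ?in_set /= ?inE ?eqxx.
Qed.

Lemma edge_adj_star (e f : edge G) (u v : G) : val e = [set u; v] ->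
  edge_adj e f = (f != e) && (f \in star u :|: star v).
Proof.
move=> ev; rewrite /edge_adj eq_sym ev !inE; congr (_ && _).
apply/set0Pn/orP => [[x]|]; first by rewrite !inE => /andP[/orP[]/eqP->]; [left|right].
by case=> xf; [exists u | exists v]; rewrite !inE eqxx ?orbT.
Qed.

(** The two stars share only [e], as an edge has just two ends. The sum of the degrees thus counts
    [e] twice and every adjacent edge once. *)
Lemma card_edge_adj (e : edge G) (u v : G) : vadj u v -> val e = [set u; v] ->
  degree u + degree v <= #|[set f : edge G | edge_adj e f]| + 2.
Proof.
move=> uv ev.
have neq : u != v by apply: contraTneq uv => ->; rewrite vadj_irrefl.
have sub : star u :&: star v \subset [set e].
  apply/subsetP => f; rewrite !inE => /andP[uf vf]; apply/eqP/val_inj.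
  apply/esym/eqP; rewrite eqEcard ev cards2 neq subUset !sub1set uf vf /=.
  by have [w [z [_ ->]]] := edgeP f; rewrite cards2; case: (w != z).
have -> : [set f | edge_adj e f] = (star u :|: star v) :\ e.
  by apply/setP => f; rewrite inE (edge_adj_star _ _ _ _ ev) in_setD1.
have := subset_leq_card sub; rewrite cards1 -!card_star.
have := cardsUI (star u) (star v).
rewrite (cardsD1 e (star u :|: star v)) => <- le1.
by rewrite addnAC addnC leq_add2l (leq_add (leq_b1 _) le1).
Qed.

Lemma strong_majority_of_star (C : eqType) (c : edge G -> C) :
    (forall x a, 2 * #|[set f in star x | c f == a]| < degree x) ->
  strong_majority_coloring c.
Proof.
move=> cP e a; have [u [v [uv ev]]] := edgeP e.
(* Each strict inequality gains 1, and together they absorb the 2 lost in [card_edge_adj]. *)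
have arith n p q d du dv : n <= p + q -> 2 * p < du -> 2 * q < dv ->
  du + dv <= d + 2 -> 2 * n <= d by lia.
apply: arith (cP u a) (cP v a) (card_edge_adj e u v uv ev).
apply: leq_trans (leq_card_setU _ _).
apply/subset_leq_card/subsetP => f; rewrite inE (edge_adj_star _ _ _ _ ev) !inE.
by case/andP => /andP[_ uvf] ->; rewrite !andbT.
Qed.

Lemma strong_majority_index_exists (k : nat) :
  strong_majority_colorable G k -> exists m, strong_majority_index G m /\ m <= k.
Proof.
(* Finite functions make colorability a boolean predicate, so that a least number of colors can be
   extracted. *)
pose P n := [exists c : {ffun edge G -> 'I_n}, forall e, forall a,
  2 * #|[set f : edge G | edge_adj e f && (c f == a)]|
    <= #|[set f : edge G | edge_adj e f]|].
have PP n : reflect (strong_majority_colorable G n) (P n).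
  apply: (iffP existsP) => [[c /forallP cP]|[c cP]].
    by exists c => e a; have /forallP := cP e.
  exists (finfun c); apply/forallP => e; apply/forallP => a.
  by apply: leq_trans (cP e a); rewrite leq_mul2l /=; apply: subset_leq_card;
     apply/subsetP => f; rewrite !inE ffunE.
move=> /PP Pk; case: (ex_minnP (ex_intro _ k Pk)) => m /PP Pm le_m.
by exists m; split; [split => // n /PP /le_m | apply: le_m].
Qed.

End StrongMajority.

Theorem theorem11 (G : sgraph) (hdelta : 7 <= min_degree G) :
  exists m : nat, strong_majority_index G m /\ m <= 4.
Proof.
apply: strong_majority_index_exists.
have ends2 (e : edge G) : #|val e| <= 2.
  by have [u [v [_ ->]]] := edgeP _ e; rewrite cards2; case: (u != v).
have [c cP] := quartering _ _ (fun e : edge G => val e) ends2.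
exists c; apply: strong_majority_of_star => x a.
have deg7 : 7 <= degree x.
  by move: hdelta; rewrite (leq_min_degree _ x) => /forallP/(_ x).
(* From [d >= 7] follows [d + 6 < 2 * d], hence [4 * n < 2 * d]. *)
have arith n d : 7 <= d -> 4 * n <= d + 6 -> 2 * n < d by lia.
apply: arith => //; rewrite -card_star.
have -> : [set f in star G x | c f == a]
    = [set e : edge G | (x \in val e) && (c e == a)].
  by apply/setP => f; rewrite !inE.
exact: cP.
Qed.
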